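(* Fix $\beta\in(0,1)$ and set $\Phi(s):=\log m(s)+\beta\log r(s)$, where $r=x_1/x_3\ge1$ is the real aspect ratio. Let $(s_t)$ be an orbit and suppose there are constants $m_0\ge1$, $C\ge1$, $c_0>0$, $K\in\mathbb N$ such that whenever $m(s_t)\ge m_0$: (H1) $\Phi(s_{t+1})\le\Phi(s_t)+\log C$; (H2) there exists $k=k(t)\in\{1,\dots,K\}$ with $\Phi(s_{t+k})\le\Phi(s_t)-c_0$. Let $t^*=\inf\{t:m(s_t)<m_0\}$. Then $$t^*\le K\,\frac{\Phi(s_0)-\log m_0}{c_0}+K,\qquad \sup_{t\le t^*}\log m(s_t)\le\Phi(s_0)+K\log C .$$
   Context: Let $F$ be a cubic number field of signature $(1,1)$, with real embedding $\sigma_r$ and complex embedding $\sigma_c$, and let $L\subset\mathcal O_F$ be an order. (In the claim, $K$ denotes a natural number, a step bound, not a field.) A state is an ordered triple $s=(u_1,u_2,u_3)$ of elements of $L$ forming a $\mathbb Q$-basis of $F$ with $x_i=\sigma_r(u_i)>0$, sorted so that $x_1\ge x_2\ge x_3>0$. Put $\xi=(x_1,x_2,x_3)$, $\hat\xi=\xi/|\xi|$, $(\sigma_c(u_1),\sigma_c(u_2),\sigma_c(u_3))=a+ib$ with $a,b\in\mathbb R^3$, $a_\perp=a-\langle a,\hat\xi\rangle\hat\xi$, $b_\perp=b-\langle b,\hat\xi\rangle\hat\xi$; the conformal module is $m(s)=(|a_\perp|^2+|b_\perp|^2)/(2|a_\perp\times b_\perp|)\ge1$. An orbit is a sequence of states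 $(s_t)_{t\ge0}$ produced by the algorithm: for $A,B,g\in\mathbb Z_{\ge0}$ not all zero, the move $V(A,B,g)$ sends $(u_1,u_2,u_3)$ to $(u_1-g(u_2-Bu_3)-Au_3,\ u_2-Bu_3,\ u_3)$, and $W$ sends it to $(u_1-u_2,\ u_2,\ u_3-(u_1-u_2))$; among the moves for which all new real coordinates are positive, one giving minimal $m$ is selected (ties broken by a fixed order on move labels), and the result is re-sorted to give $s_{t+1}$.
   Formalization: The first bound is stated as t* ≤ max(0, K(Φ(s_0) − log m_0)/c_0 + K), because when m(s_0) < m_0 we have t* = 0 while the original right-hand side can be negative; if m(s_0) ≥ m_0 it is the original bound. *)

(* Defs.v *)
From HB Require Import structures.
From mathcomp Require Import all_boot all_order all_algebra all_field.
From mathcomp Require Import all_classical all_reals all_analysis.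
From mathcomp Require Import complex.

Set Implicit Arguments.
Unset Strict Implicit.
Unset Printing Implicit Defensive.

Import Order.TTheory GRing.Theory Num.Theory.
Local Open Scope classical_set_scope.
Local Open Scope ring_scope.

(* The Euclidean structure of R^3 is written out because the library norm on
   row vectors is the sup norm. *)
Section Euclidean3.
Variable R : realType.
Implicit Types u v : 'rV[R]_3.

Definition vec3 (x y z : R) : 'rV[R]_3 := \row_(i < 3) [:: x; y; z]`_i.

Definition dot3 u v : R := \sum_i u 0 i * v 0 i.

Definition norm3 u : R := Num.sqrt (dot3 u u).

Definition cross3 u v : 'rV[R]_3 :=
  let: (i0, i1, i2) := (inord 0, inord 1, inord 2) : 'I_3 * 'I_3 * 'I_3 in
  vec3 (u 0 i1 * v 0 i2 - u 0 i2 * v 0 i1)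
       (u 0 i2 * v 0 i0 - u 0 i0 * v 0 i2)
       (u 0 i0 * v 0 i1 - u 0 i1 * v 0 i0).

Definition perp3 (w u : 'rV[R]_3) : 'rV[R]_3 :=
  let w1 := (norm3 w)^-1 *: w in u - dot3 u w1 *: w1.

End Euclidean3.

Section NumberFields.
Variables (R : realType) (F : fieldExtType rat).

Definition embedding (f : F -> R[i]) : Prop :=
  GRing.zmod_morphism f /\ GRing.monoid_morphism f.

Definition real_valued (f : F -> R[i]) : Prop := forall x, complex.Im (f x) = 0.

Definition has_signature (r1 r2 : nat) : Prop :=
  ([set f | embedding f /\ real_valued f] #= `I_r1)%card /\
  ([set f | embedding f /\ ~ real_valued f] #= `I_(2 * r2)%N)%card.

Definition ring_of_integers : set F :=
  [set x | integralOver (intr : int -> F) x].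

(* A subring of the ring of integers which is the Z-span of a Q-basis of F. *)
Definition is_order (L : {pred F}) : Prop :=
  [/\ GRing.subring_closed L,
      {in L, forall x, ring_of_integers x} &
      exists2 e : (\dim {:F}).-tuple F, basis_of {:F} e &
        forall x : F, x \in L <->
          exists c : 'I_(\dim {:F}) -> int, x = \sum_(i < \dim {:F}) e`_i *~ c i].

End NumberFields.

Inductive move := MoveV of nat & nat & nat | MoveW.

Definition valid_move (mv : move) : bool :=
  if mv is MoveV A B g then ~~ [&& A == 0, B == 0 & g == 0]%N else true.

Section Algorithm.
Variables (R : realType) (F : fieldExtType rat).
Variables (sr : {rmorphism F -> R}) (sc : {rmorphism F -> R[i]}).
Variable L : {pred F}.
Implicit Types s : 3.-tuple F.

Definition is_state s : Prop :=
  [/\ {subset s <= L}, basis_of {:F} s, {in s, forall u, 0 < sr u} &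
      sr s`_1 <= sr s`_0 /\ sr s`_2 <= sr s`_1].

(* Defined on all triples, sorted or not. *)
Definition conformal_module s : R :=
  let xi := vec3 (sr s`_0) (sr s`_1) (sr s`_2) in
  let a := vec3 (complex.Re (sc s`_0)) (complex.Re (sc s`_1))
                (complex.Re (sc s`_2)) in
  let b := vec3 (complex.Im (sc s`_0)) (complex.Im (sc s`_1))
                (complex.Im (sc s`_2)) in
  (norm3 (perp3 xi a) ^+ 2 + norm3 (perp3 xi b) ^+ 2) /
    (2 * norm3 (cross3 (perp3 xi a) (perp3 xi b))).

Definition aspect_ratio s : R := sr s`_0 / sr s`_2.

Definition potential (beta : R) s : R :=
  ln (conformal_module s) + beta * ln (aspect_ratio s).

Definition apply_move (mv : move) s : 3.-tuple F :=
  let: (u1, u2, u3) := (s`_0, s`_1, s`_2) in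
  match mv with
  | MoveV A B g =>
      [tuple u1 - (u2 - u3 *+ B) *+ g - u3 *+ A; u2 - u3 *+ B; u3]
  | MoveW => [tuple u1 - u2; u2; u3 - (u1 - u2)]
  end.

Definition admissible s (mv : move) : Prop :=
  valid_move mv /\ {in apply_move mv s, forall u, 0 < sr u}.

(* The conformal module does not depend on the order of the entries, so
   minimizing it before or after re-sorting is the same. *)
Definition selected (tie : rel move) s (mv : move) : Prop :=
  admissible s mv /\
  forall mv', admissible s mv' ->
    let m := conformal_module (apply_move mv s) in
    let m' := conformal_module (apply_move mv' s) in
    m < m' \/ (m = m' /\ tie mv mv').

Definition resort s : 3.-tuple F :=
  [tuple of sort (fun u v => sr v <= sr u) s].

Definition is_orbit (tie : rel move) (s : nat -> 3.-tuple F) : Prop :=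
  (forall t, is_state (s t)) /\
  (forall t, exists2 mv, selected tie (s t) mv &
                         s t.+1 = resort (apply_move mv (s t))).

(* inf {t | m (s t) < m0}, equal to +oo when there is no such t. *)
Definition hitting_time (s : nat -> 3.-tuple F) (m0 : R) : \bar R :=
  ereal_inf [set (t%:R)%:E | t in [set t | conformal_module (s t) < m0]].

End Algorithm.

(* Main.v *)
Require Import Defs.
From HB Require Import structures.
From mathcomp Require Import all_boot all_order all_algebra all_field.
From mathcomp Require Import all_classical all_reals all_analysis.
From mathcomp Require Import complex.
From mathcomp Require Import zify.

(** The argument is a Lyapunov drift argument for the potential Phi along the
orbit.  The potential dominates the quantity to be controlled: ln m <= Phi,
because the entries of a state are sorted and so have aspect ratio at least 1
([ln_conformal_module_le_potential]).

Call a time active if m >= m0 there.  Starting from time 0 and jumping from an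
active time t to t + k(t), one visits checkpoints; consecutive ones are at most
K apart, and the j-th one satisfies Phi <= Phi(s_0) - j c0.  Every time N > 0
preceded only by active times is at most K after some active checkpoint
([last_checkpoint]).  At that checkpoint Phi is still at least ln m0, so its
index is at most (Phi(s_0) - ln m0) / c0, which bounds N
([active_run_length_le]); and from that checkpoint to N the potential gains at
most ln C in each of at most K steps, which bounds Phi at N
([active_run_value_le]).  The first bound forces the hitting time to be a
finite number, and both bounds then apply up to it. *)

Set Implicit Arguments.
Unset Strict Implicit.
Unset Printing Implicit Defensive.

Import Order.TTheory GRing.Theory Num.Theory.
Local Open Scope classical_set_scope.
Local Open Scope ring_scope.

Section Drift.
Variables (R : realType) (f : nat -> R) (active : nat -> Prop).
Variables (d c0 : R) (K : nat).
Hypothesis step_le : forall t, active t -> f t.+1 <= f t + d.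
Hypothesis drop : forall t, active t ->
  exists2 k : nat, (1 <= k <= K)%N & f (t + k)%N <= f t - c0.

(** The checkpoint [t] of index [j] is replaced by the next one [t + k] only
when the latter has been passed; as [k >= 1], the new checkpoint is again at
distance at most [K] from the current time. *)
Lemma last_checkpoint N : (0 < N)%N -> (forall t, (t < N)%N -> active t) ->
  exists t j, [/\ (t < N <= t + K)%N, (t <= j * K)%N & f t <= f 0%N - j%:R * c0].
Proof.
elim: N => [//|N IHN] _ actN.
have [N0|N_gt0] := posnP N.
  have [k /andP[k1 kK] _] := drop (actN 0%N isT).
  exists 0%N, 0%N; split=> //; last by rewrite mul0r subr0.
  by rewrite N0 add0n (leq_trans k1 kK).
have [t [j [/andP[tN NK] tj ftj]]] := IHN N_gt0 (fun t tN => actN t (ltnW tN)).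
have [k /andP[k1 kK] fk] := drop (actN t (ltnW tN)).
have [kN|Nk] := leqP (t + k) N.
  exists (t + k)%N, j.+1; split; [by lia | by rewrite mulSn; lia |].
  by rewrite -natr1 mulrDl mul1r opprD addrA (le_trans fk)// lerD2r.
by exists t, j; split=> //; lia.
Qed.

Lemma active_run_length_le (a : R) N : 0 < c0 ->
  (forall t, active t -> a <= f t) ->
  (0 < N)%N -> (forall t, (t < N)%N -> active t) ->
  N%:R <= K%:R * ((f 0%N - a) / c0) + K%:R.
Proof.
move=> c0_gt0 a_le N_gt0 actN.
have [t [j [/andP[tN NK] tj ftj]]] := last_checkpoint N_gt0 actN.
have j_le : j%:R <= (f 0%N - a) / c0.
  by rewrite ler_pdivlMr// lerBrDl -lerBrDr (le_trans _ ftj)//; exact/a_le/actN.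
have /le_trans -> // : N%:R <= K%:R * j%:R + K%:R :> R.
  by rewrite -natrM -natrD ler_nat mulnC (leq_trans NK)// leq_add2r.
by rewrite lerD2r ler_wpM2l.
Qed.

Lemma iter_step_le t n : (forall i, (i < n)%N -> active (t + i)) ->
  f (t + n)%N <= f t + n%:R * d.
Proof.
elim: n => [|n IHn] actn; first by rewrite addn0 mul0r addr0.
rewrite addnS -natr1 mulrDl mul1r addrA.
apply: le_trans (step_le (actn n (ltnSn n))) _.
by rewrite lerD2r IHn// => i /ltnW /actn.
Qed.

Lemma active_run_value_le N : 0 <= c0 -> 0 <= d ->
  (forall t, (t < N)%N -> active t) -> f N <= f 0%N + K%:R * d.
Proof.
move=> c0_ge0 d_ge0 actN.
have [->|N_gt0] := posnP N; first by rewrite lerDl mulr_ge0.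
have [t [j [/andP[tN NK] tj ftj]]] := last_checkpoint N_gt0 actN.
have actt i : (i < N - t)%N -> active (t + i) by move=> ?; apply: actN; lia.
have := iter_step_le actt; rewrite subnKC; last exact: ltnW.
move=> /le_trans -> //; apply: lerD.
  by rewrite (le_trans ftj)// gerBl mulr_ge0.
by rewrite ler_wpM2r// ler_nat; lia.
Qed.

End Drift.

Section Orbit.
Variables (R : realType) (F : fieldExtType rat).
Variables (sr : {rmorphism F -> R}) (sc : {rmorphism F -> R[i]}).

Lemma aspect_ratio_ge1 (L : {pred F}) (s : 3.-tuple F) :
  is_state sr L s -> 1 <= aspect_ratio sr s.
Proof.
move=> [_ _ s_pos [s10 s21]].
have s2_gt0 : 0 < sr s`_2 by apply: s_pos; rewrite mem_nth// size_tuple.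
by rewrite /aspect_ratio ler_pdivlMr// mul1r (le_trans s21).
Qed.

Lemma ln_conformal_module_le_potential (L : {pred F}) (beta : R)
    (s : 3.-tuple F) : 0 <= beta -> is_state sr L s ->
  ln (conformal_module sr sc s) <= potential sr sc beta s.
Proof.
move=> beta_ge0 /aspect_ratio_ge1 r_ge1.
by rewrite lerDl mulr_ge0// ln_ge0.
Qed.

Lemma hitting_timeE (s : nat -> 3.-tuple F) (m0 : R) N :
  conformal_module sr sc (s N) < m0 ->
  (forall t, (t < N)%N -> m0 <= conformal_module sr sc (s t)) ->
  hitting_time sr sc s m0 = N%:R%:E.
Proof.
move=> mN m_ge; apply/eqP; rewrite eq_le; apply/andP; split.
  by apply: ereal_inf_lbound; exists N.
apply: le_ereal_inf_tmp => _ [t /= mt <-]; rewrite lee_fin ler_nat leqNgt.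
by apply/negP => /m_ge; rewrite leNgt mt.
Qed.

End Orbit.

Theorem lemma4p1 (R : realType) (F : fieldExtType rat)
  (dimF : \dim {:F} = 3%N) (sigF : has_signature R F 1 1)
  (sr : {rmorphism F -> R})
  (sc : {rmorphism F -> R[i]}) (sc_nonreal : ~ real_valued sc)
  (L : {pred F}) (L_order : is_order L)
  (tie : rel move) (tie_total : total tie) (tie_trans : transitive tie)
  (tie_anti : antisymmetric tie)
  (beta : R) (beta_gt0 : 0 < beta) (beta_lt1 : beta < 1)
  (s : nat -> 3.-tuple F) (s_orbit : is_orbit sr sc L tie s)
  (m0 C c0 : R) (K : nat) (m0_ge1 : 1 <= m0) (C_ge1 : 1 <= C)
  (c0_gt0 : 0 < c0) :
  let m := conformal_module sr sc in
  let Phi := potential sr sc beta in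
  (forall t, m0 <= m (s t) -> Phi (s t.+1) <= Phi (s t) + ln C) ->
  (forall t, m0 <= m (s t) ->
     exists2 k : nat, (1 <= k <= K)%N & Phi (s (t + k)%N) <= Phi (s t) - c0) ->
  let tstar := hitting_time sr sc s m0 in
  (* The maximum with 0 only matters when m (s 0) < m0, i.e. t* = 0: the
     right-hand side may then be negative. *)
  (tstar <= (Num.max 0 (K%:R * ((Phi (s 0%N) - ln m0) / c0) + K%:R))%:E)%E /\
  (ereal_sup [set (ln (m (s t)))%:E | t in [set t : nat | (t%:R%:E <= tstar)%E]]
     <= (Phi (s 0%N) + K%:R * ln C)%:E)%E.
Proof.
move=> m Phi H1 H2 tstar.
have st t : is_state sr L (s t) by have [+ _] := s_orbit; apply.
have m_le t : ln (m (s t)) <= Phi (s t).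
  by apply: ln_conformal_module_le_potential (st t); exact: ltW.
pose active t := m0 <= m (s t).
have Phi_ge t : active t -> ln m0 <= Phi (s t).
  move=> mt; have m0_gt0 : 0 < m0 by rewrite (lt_le_trans ltr01).
  by rewrite (le_trans _ (m_le t))// ler_ln// posrE (lt_le_trans m0_gt0).
have lnC_ge0 : 0 <= ln C by exact: ln_ge0.
pose f t := Phi (s t).
pose B := K%:R * ((f 0%N - ln m0) / c0) + K%:R.
have run_le N : (0 < N)%N -> (forall t, (t < N)%N -> active t) -> N%:R <= B.
  exact: (@active_run_length_le R f active c0 K H2 (ln m0) N c0_gt0 Phi_ge).
(* A run of active times longer than the bound is impossible. *)
have hit : exists t, m (s t) < m0.
  apply: contrapT => /forallNP no_hit.
  have := run_le (Num.truncn B).+1 isT.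
  rewrite leNgt truncnS_gt => run_le_B; suff: false by []; apply: run_le_B.
  by move=> t _; rewrite /active leNgt; apply/negP/no_hit.
have [N mN minN] := ex_minnP hit.
have actN t : (t < N)%N -> active t.
  by rewrite /active; apply: contraTT; rewrite -ltNge -leqNgt => /minN.
have -> : tstar = N%:R%:E by exact: hitting_timeE.
split.
  rewrite lee_fin le_max; have [->|N_gt0] := posnP N; first by rewrite lexx.
  by rewrite -/B run_le ?orbT.
apply: ge_ereal_sup => _ [t /= tN <-]; rewrite lee_fin (le_trans (m_le t))//.
move: tN; rewrite lee_fin ler_nat => tN.
apply: (@active_run_value_le R f active (ln C) c0 K H1 H2 t (ltW c0_gt0)) => //.
by move=> i it; apply: actN; exact: leq_trans tN.
Qed.
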